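(* Let $n\ge 2$ be an integer. (i) Let $A=(a_1,\ldots,a_n)\in\mathbb{Z}^{1\times n}$ with $a_i\in\mathbb{Z}_{>0}$ for all $i=1,\ldots,n$ and $\gcd(a_1,\ldots,a_n)=1$, and let $\boldsymbol c\in\mathbb{Q}^n$. Then $$\mathrm{Gap}_{\boldsymbol c}(A)\le \left(\|A\|_\infty-1\right)\|\boldsymbol c\|_1 .$$ (ii) For any positive integer $k$ there exist $A=(a_1,\ldots,a_n)\in\mathbb{Z}^{1\times n}$ with all $a_i\in\mathbb{Z}_{>0}$, $\gcd(a_1,\ldots,a_n)=1$ and $\|A\|_\infty=k$, and $\boldsymbol c\in\mathbb{Q}^n$, such that $$\mathrm{Gap}_{\boldsymbol c}(A)= \left(\|A\|_\infty-1\right)\|\boldsymbol c\|_1 .$$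
   Context: For $A=(a_1,\ldots,a_n)\in\mathbb{Z}^{1\times n}$ with positive entries, $b\in\mathbb{Z}$ and $\boldsymbol c\in\mathbb{Q}^n$, let $IP_{\boldsymbol c}(A,b)=\min\{\boldsymbol c\cdot\boldsymbol x: A\boldsymbol x=b,\ \boldsymbol x\in\mathbb{Z}^n_{\ge0}\}$ (the integer knapsack problem) and $LP_{\boldsymbol c}(A,b)=\min\{\boldsymbol c\cdot\boldsymbol x: A\boldsymbol x=b,\ \boldsymbol x\in\mathbb{R}^n_{\ge0}\}$ (its linear programming relaxation). When the integer problem is feasible and bounded, the (additive) integrality gap is $IG_{\boldsymbol c}(A,b)=IP_{\boldsymbol c}(A,b)-LP_{\boldsymbol c}(A,b)$. The integer programming gap is $\mathrm{Gap}_{\boldsymbol c}(A)=\max_b IG_{\boldsymbol c}(A,b)$, where $b$ ranges over all integers for which the integer problem is feasible and bounded. Further, $\|A\|_\infty=\max_i|a_i|$ and $\|\boldsymbol c\|_1=\sum_{i=1}^n|c_i|$. *)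

(* Defs.v *)
From mathcomp Require Import all_boot all_order all_algebra.
From mathcomp Require Import boolp classical_sets reals.
Set Implicit Arguments.
Unset Strict Implicit.
Unset Printing Implicit Defensive.
Import Order.TTheory GRing.Theory Num.Theory.
Local Open Scope classical_set_scope.
Local Open Scope ring_scope.

Section Norms.
Context {n : nat}.

Definition row_gcd (A : 'rV[int]_n) : nat := \big[gcdn/0%N]_(i < n) `|A 0%R i|%N.

(* The base value 0 is harmless: the absolute values are nonnegative. *)
Definition normoo (A : 'rV[int]_n) : int := \big[Num.max/0]_(i < n) `|A 0 i|.

Definition norm1 (c : 'rV[rat]_n) : rat := \sum_(i < n) `|c 0 i|.

End Norms.

Section Programs.
Context {R : realType} {n : nat}.
Implicit Types (A : 'rV[int]_n) (b : int) (c : 'rV[rat]_n) (x : 'cV[R]_n).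

Definition is_min (S : set R) (m : R) : Prop := S m /\ lbound S m.

Definition objective c x : R := \sum_(i < n) ratr (c 0 i) * x i 0.

Definition LP_feasible A b : set 'cV[R]_n :=
  [set x | map_mx intr A *m x = (b%:~R)%:M /\ forall i, 0 <= x i 0].

Definition IP_feasible A b : set 'cV[int]_n :=
  [set x | A *m x = b%:M /\ forall i, 0 <= x i 0].

Definition LP_values c A b : set R :=
  [set objective c x | x in LP_feasible A b].

Definition IP_values c A b : set R :=
  [set objective c (map_mx intr x) | x in IP_feasible A b].

Definition IP_feasible_bounded c A b : Prop :=
  IP_feasible A b !=set0 /\ has_lbound (IP_values c A b).

(* Minima and maxima are partial, so the integrality gap and the integer
   programming gap are relations: [is_IG c A b g] says that both optima exist
   and that their difference is [g]. *)
Definition is_IG c A b (g : R) : Prop :=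
  exists ip lp : R, [/\ is_min (IP_values c A b) ip,
                        is_min (LP_values c A b) lp & g = ip - lp].

(* Every admissible [b] is required to have an integrality gap, so that the
   maximum cannot silently skip some [b]. *)
Definition is_Gap c A (g : R) : Prop :=
  (exists2 b, IP_feasible_bounded c A b & is_IG c A b g) /\
  (forall b, IP_feasible_bounded c A b -> exists2 h, is_IG c A b h & h <= g).

Lemma is_min_unique S m m' : is_min S m -> is_min S m' -> m = m'.
Proof.
move=> [Sm mS] [Sm' m'S]; apply/eqP; rewrite eq_le.
by apply/andP; split; [exact: mS | exact: m'S].
Qed.

Lemma is_IG_unique c A b g g' : is_IG c A b g -> is_IG c A b g' -> g = g'.
Proof.
move=> [ip [lp [mi ml ->]]] [ip' [lp' [mi' ml' ->]]].
by rewrite (is_min_unique mi mi') (is_min_unique ml ml').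
Qed.

Lemma is_Gap_unique c A g g' : is_Gap c A g -> is_Gap c A g' -> g = g'.
Proof.
move=> [[b Hb gb] ub] [[b' Hb' gb'] ub']; apply/eqP; rewrite eq_le.
have [h hb hg'] := ub' _ Hb; have [h' hb' hg] := ub _ Hb'.
by rewrite {1}(is_IG_unique gb hb) hg' (is_IG_unique gb' hb') hg.
Qed.

End Programs.

(* Main.v *)
(* Let j minimise c_i / a_i and let r be this minimum: the relaxation has value
   r b, so IG(b) is the least reduced cost sum_i (c_i - r a_i) x_i >= 0 over the
   integer solutions x. Item j is free for the reduced cost, and among any a_j
   items some nonempty group has weight divisible by a_j, hence can be traded
   for copies of j. An optimal solution thus uses at most a_j - 1 paid items,
   each of reduced cost at most |c_i| + |c_j| a_i / a_j; it also follows that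
   only finitely many values of IG occur, so that the maximum exists. Equality
   holds for A = (k, ..., k, 1), c = e_n and b = k - 1. *)
Require Import Defs.
From mathcomp Require Import all_boot all_order all_algebra.
From mathcomp Require Import boolp classical_sets reals.
From mathcomp Require Import zify ring lra.
Set Implicit Arguments.
Unset Strict Implicit.
Unset Printing Implicit Defensive.
Import Order.TTheory GRing.Theory Num.Theory.
Local Open Scope ring_scope.

(** * Zero-sum blocks modulo [m] *)

Lemma zero_sum_infix (I : Type) (a : I -> nat) (m : nat) (s : seq I) :
  (0 < m <= size s)%N ->
  exists s1 z s2, [/\ s = s1 ++ z ++ s2, (0 < size z)%N
                    & (m %| \sum_(i <- z) a i)%N].
Proof.
case: m => // m /= ms.
(* Two of the [m.+2] prefix sums agree modulo [m.+1]. *)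
pose f (k : 'I_m.+2) : 'I_m.+1 := inZp (\sum_(i <- take k s) a i)%N.
have /injectivePn[k [l kl fkl]] : ~~ injectiveb f.
  by apply/injectiveP => /leq_card; rewrite !card_ord ltnn.
wlog {kl} kl : k l fkl / (k < l)%N.
  move=> W; have : (k != l :> nat) by [].
  by rewrite neq_ltn => /orP[] ?; [exact: (W k l) | exact: (W l k)].
exists (take k s), (drop k (take l s)), (drop l s); split.
- by rewrite catA -{1}(take_takel s (ltnW kl)) cat_take_drop cat_take_drop.
- rewrite size_drop size_takel ?subn_gt0 //.
  by have := ltn_ord l; lia.
(* The longer prefix is the shorter one followed by the block, so cancelling the shorter one from
   the congruence leaves a block sum of 0 modulo [m.+1]. *)
- move: fkl => /(congr1 val) /= /esym/eqP.
  rewrite -{1}(cat_take_drop k (take l s)) take_takel ?(ltnW kl)//.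
  by rewrite big_cat /= -[X in (_ == X %[mod _])%N]addn0 eqn_modDl mod0n.
Qed.

(** Delete zero-sum blocks as long as at least [m] entries remain. The deleted weight accumulates in
    [t * m], and since [d] is nonnegative the total cost cannot increase. *)
Lemma zero_sum_reduction (K : numDomainType) (I : Type) (a : I -> nat)
    (d : I -> K) (m : nat) (s : seq I) :
  (0 < m)%N -> (forall i, 0 <= d i) ->
  exists s' t, [/\ (size s' < m)%N,
    (\sum_(i <- s) a i = t * m + \sum_(i <- s') a i)%N
    & \sum_(i <- s') d i <= \sum_(i <- s) d i].
Proof.
move=> m0 d0; have [p] := ubnP (size s); elim: p s => // p IH s sp.
have [sm|ms] := ltnP (size s) m; first by exists s, 0%N.
have [|s1 [z [s2 [es z0 /dvdnP[q eq]]]]] := @zero_sum_infix _ a m s.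
  by rewrite m0.
have [|s' [t [s'm es' ds']]] := IH (s1 ++ s2).
  by move: sp; rewrite es !size_cat; lia.
exists s', (t + q)%N; split => //.
  move: es'; rewrite es !big_cat /= eq mulnDl; lia.
apply: le_trans ds' _; rewrite es !big_cat /= lerD2l lerDr.
exact: sumr_ge0.
Qed.

(** * Reduced costs and the upper bound on the gap *)

Section Knapsack.
Context {R : realType} {n : nat}.
Variables (A : 'rV[int]_n) (c : 'rV[rat]_n).

(* A nonnegative integer vector is encoded as a list of indices with
   multiplicities, on which zero_sum_reduction acts. *)
Lemma IP_valuesP (b : int) (v : R) :
  IP_values c A b v <->
  exists2 s : seq 'I_n, b = \sum_(i <- s) A 0 i
                      & v = \sum_(i <- s) ratr (c 0 i).
Proof.
split=> [[x [Ax x0] <-]|[s -> ->]].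
  exists (flatten [seq nseq `|x i 0%R|%N i | i <- index_enum 'I_n]).
    have := congr1 (fun B : 'M_1 => B 0 0) Ax; rewrite !mxE mulr1n => <-.
    rewrite big_flatten big_map; apply: eq_bigr => i _.
    by rewrite big_nseq iter_addr addr0 -mulr_natr natz gez0_abs.
  rewrite big_flatten big_map; apply: eq_bigr => i _.
  by rewrite big_nseq iter_addr addr0 -mulr_natr mxE -{1}(gez0_abs (x0 i)).
elim: s => [|i s [x [Ax x0] objx]].
  rewrite !big_nil; exists 0.
    by split=> [|i]; rewrite ?mulmx0 ?mxE// raddf0.
  by rewrite /objective big1// => i _; rewrite !mxE mulr0.
exists (x + delta_mx i 0).
  split=> [|k]; last by rewrite !mxE addr_ge0// ler0n.
  rewrite mulmxDr Ax -colE big_cons addrC; apply/matrixP => k l.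
  by rewrite !ord1 !mxE !mulr1n.
rewrite big_cons -objx /objective (bigD1 i)//= [in RHS](bigD1 i)//=.
rewrite !mxE !eqxx rmorphD/= mulrDr mulr1 -addrA addrCA; congr (_ + (_ + _)).
by apply: eq_bigr => k /negPf ki; rewrite !mxE ki addr0.
Qed.

Hypothesis A_gt0 : forall i, 0 < A 0 i.

Lemma le_normoo i : A 0 i <= normoo A.
Proof.
by apply: le_trans (ler_norm _) _; rewrite /normoo; exact: le_bigmax.
Qed.

Variable j : 'I_n.
Hypothesis j_min : forall i, c 0 j / (A 0 j)%:~R <= c 0 i / (A 0 i)%:~R.

(** The optimal dual multiplier of the relaxation; [reduced_cost] is the corresponding dual
    slack. *)
Definition best_ratio : R := ratr (c 0 j / (A 0 j)%:~R).

Definition reduced_cost i : R := ratr (c 0 i) - best_ratio * (A 0 i)%:~R.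

Lemma reduced_cost_ge0 i : 0 <= reduced_cost i.
Proof.
rewrite subr_ge0 -(ratr_int R (A 0 i)) -rmorphM/= ler_rat.
by rewrite -ler_pdivlMr ?ltr0z.
Qed.

Lemma reduced_costj : reduced_cost j = 0.
Proof.
rewrite /reduced_cost /best_ratio -(ratr_int R (A 0 j)) -rmorphM/= divfK ?subrr//.
by rewrite intr_eq0 gt_eqF.
Qed.

(** The first summand depends only on the total weight, so for fixed [b] minimising the cost amounts
    to minimising the reduced cost. *)
Lemma cost_reduced (s : seq 'I_n) :
  \sum_(i <- s) ratr (c 0 i) =
  best_ratio * (\sum_(i <- s) A 0 i)%:~R + \sum_(i <- s) reduced_cost i.
Proof.
rewrite rmorph_sum mulr_sumr -big_split; apply: eq_bigr => i _.
by rewrite /reduced_cost/= addrC subrK.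
Qed.

(** The value is attained by using item [j] alone, in the fractional amount [b / A 0 j]; weak
    duality with multiplier [best_ratio] gives the lower bound. *)
Lemma LP_min (b : int) : 0 <= b ->
  is_min (LP_values c A b) (best_ratio * b%:~R).
Proof.
move=> b0; have Aj0 : (A 0 j)%:~R != 0 :> R by rewrite intr_eq0 gt_eqF.
split.
  exists ((b%:~R / (A 0 j)%:~R) *: delta_mx j 0).
    split=> [|i]; last first.
      by rewrite !mxE mulr_ge0 ?divr_ge0 ?ler0z ?ler0n// ltW.
    rewrite -scalemxAr -colE; apply/matrixP => k l.
    by rewrite !ord1 !mxE mulr1n divfK.
  rewrite /objective (bigD1 j)//= big1 ?addr0 => [|i /negPf ij].
    rewrite !mxE !eqxx /best_ratio rmorphM/= fmorphV/= ratr_int.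
    by ring.
  by rewrite !mxE ij !mulr0.
move=> _ [x [Ax x0] <-].
have := congr1 (fun B : 'M_1 => B 0 0) Ax; rewrite !mxE mulr1n => <-.
rewrite mulr_sumr; apply: ler_sum => i _; rewrite mxE mulrA ler_wpM2r//.
by rewrite -subr_ge0; exact: reduced_cost_ge0.
Qed.

(** Lists of bounded length form a finite type, so a cheapest one exists; this makes the integer
    minimum attained for every feasible [b]. *)
Lemma IG_reduced (b : int) : (exists x, IP_feasible A b x) ->
  exists s : (`|A 0%R j|%N.-1).-bseq 'I_n,
    is_IG c A b (\sum_(i <- s) reduced_cost i).
Proof.
pose m := `|A 0%R j|%N; have m0 : (0 < m)%N by rewrite absz_gt0 gt_eqF.
have Aj : A 0 j = m%:Z by rewrite gez0_abs ?ltW.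
have sumA (s : seq 'I_n) :
    \sum_(i <- s) A 0 i = (\sum_(i <- s) `|A 0%R i|)%N%:Z.
  by rewrite -natz natr_sum; apply: eq_bigr => i _; rewrite natz gez0_abs ?ltW.
(* The [t] copies of [j] that complete [s] to weight [b] are not stored: [b] and [s] determine [t],
   and these copies have reduced cost 0. *)
pose P (s : m.-1.-bseq 'I_n) :=
  `[< exists t : nat, b = t%:Z * A 0 j + \sum_(i <- s) A 0 i >].
have red (s : seq 'I_n) : b = \sum_(i <- s) A 0 i -> exists2 s', P s' &
    \sum_(i <- s') reduced_cost i <= \sum_(i <- s) reduced_cost i.
  move=> bs; have [s' [t [s'm es' ds']]] :=
    zero_sum_reduction (fun i => `|A 0%R i|%N) s m0 reduced_cost_ge0.
  have s'm' : (size s' <= m.-1)%N by rewrite -ltnS prednK.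
  exists (Bseq s'm') => //; apply/asboolP; exists t.
  by rewrite bs !sumA es' Aj PoszD PoszM.
move=> [x Ax].
have /IP_valuesP[s bs _] : IP_values c A b (objective c (map_mx intr x) : R).
  by exists x.
have [s0 Ps0 _] := red s bs.
case: (arg_minP (fun s : m.-1.-bseq 'I_n => \sum_(i <- s) reduced_cost i) Ps0).
move=> s1 /asboolP[t bt] s1min; exists s1.
exists (best_ratio * b%:~R + \sum_(i <- s1) reduced_cost i), (best_ratio * b%:~R).
split; last by rewrite addrC addKr.
- split.
    apply/IP_valuesP; exists (nseq t j ++ s1).
      by rewrite big_cat/= big_nseq iter_addr addr0 bt -mulr_natl natz.
    rewrite cost_reduced !big_cat/= !big_nseq !iter_addr !addr0 reduced_costj.
    by rewrite mul0rn add0r bt -[in RHS]mulr_natl natz.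
  move=> v /IP_valuesP[s2 bs2 ->]; rewrite cost_reduced -bs2 lerD2l.
  by have [s3 /s1min s13] := red s2 bs2; exact: le_trans.
- by apply: LP_min; rewrite bs; apply: sumr_ge0 => i _; exact: ltW.
Qed.

(** The factor [A 0 j - 1] is the maximal length of an optimal list, so this is the bound for a list
    of that length repeating [i]. *)
Lemma reduced_cost_le i :
  (A 0 j - 1)%:~R * reduced_cost i <= (normoo A - 1)%:~R * ratr (norm1 c).
Proof.
have A1 k : 1 <= (A 0 k)%:~R :> R by rewrite ler1z -gtz0_ge1.
have AM k : (A 0 k)%:~R <= (normoo A)%:~R :> R by rewrite ler_int le_normoo.
have M1 := le_trans (A1 j) (AM j).
have N0 : 0 <= ratr (norm1 c) :> R.
  by rewrite ler0q; apply: sumr_ge0.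
have [->|ij] := eqVneq i j.
  by rewrite reduced_costj mulr0 mulr_ge0// rmorphB/= subr_ge0.
(* As [i] and [j] differ, these are two separate terms of the norm. *)
have N2 : `|ratr (c 0 i)| + `|ratr (c 0 j)| <= ratr (norm1 c) :> R.
  rewrite /norm1 (bigD1 i)//= (bigD1 j)/= 1?eq_sym// !rmorphD/= !ratr_norm.
  by rewrite lerD2l lerDl ler0q; apply: sumr_ge0.
rewrite !rmorphB/=; apply: le_trans (ler_wpM2l _ N2); last by rewrite subr_ge0.
rewrite /reduced_cost /best_ratio rmorphM/= fmorphV/= ratr_int.
set x := ratr (c 0 i); set y := ratr (c 0 j).
move: (A1 i) (A1 j) (AM i) (AM j) M1.
set ai := (A 0 i)%:~R; set m := (A 0 j)%:~R; set M := (normoo A)%:~R.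
move=> ai1 m1 aiM mM M1.
(* The upper bound is [ai * (m - 1) <= M * m - M <= (M - 1) * m], using [ai <= M] and then
   [m <= M]. *)
have coef : 0 <= ai * (m - 1) / m <= M - 1.
  rewrite divr_ge0 ?mulr_ge0 ?subr_ge0//=; [|lra|lra].
  by rewrite ler_pdivrMr; [nra|lra].
have -> : (m - 1) * (x - y / m * ai) = (m - 1) * x + (ai * (m - 1) / m) * - y.
  by ring.
rewrite [leRHS]mulrDr; apply: lerD.
  apply: (@le_trans _ _ ((m - 1) * `|x|)).
    by rewrite ler_wpM2l ?ler_norm ?subr_ge0.
  by rewrite ler_wpM2r ?lerD2r.
have /andP[coef0 coefM] := coef.
apply: (@le_trans _ _ (ai * (m - 1) / m * `|y|)).
  by rewrite ler_wpM2l// -normrN ler_norm.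
by rewrite ler_wpM2r.
Qed.

Lemma sum_reduced_cost_le (s : (`|A 0%R j|%N.-1).-bseq 'I_n) :
  \sum_(i <- s) reduced_cost i <= (normoo A - 1)%:~R * ratr (norm1 c).
Proof.
set T := _ * ratr _.
have Ajm : A 0 j - 1 = (`|A 0%R j|%N.-1)%:Z by have := A_gt0 j; lia.
have T0 : 0 <= T.
  by have := reduced_cost_le j; rewrite reduced_costj mulr0.
(* If [A 0 j = 1] the list is empty; otherwise the length bound is positive and can be multiplied
   through. *)
have [m1|m1] := posnP `|A 0%R j|%N.-1.
  have : nilp s by rewrite /nilp -leqn0 (leq_trans (size_bseq s)) ?m1.
  by move=> /nilP ->; rewrite big_nil.
rewrite -(ler_pM2l (_ : 0 < (`|A 0%R j|%N.-1)%:R)) ?ltr0n// mulr_sumr.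
apply: (@le_trans _ _ (\sum_(i <- s) T)).
  by apply: ler_sum => i _; have := reduced_cost_le i; rewrite Ajm.
rewrite big_const_seq iter_addr addr0 count_predT -[T *+ _]mulr_natl.
by rewrite ler_wpM2r// ler_nat size_bseq.
Qed.

(** Infinitely many [b] are admissible, but their gaps are all values of one function on a finite
    type of lists. A list maximising it among those realised by some [b] gives the maximum. *)
Lemma Gap_le :
  exists2 g : R, is_Gap c A g & g <= (normoo A - 1)%:~R * ratr (norm1 c).
Proof.
have bounded b : (exists x, IP_feasible A b x) ->
    IP_feasible_bounded (R := R) c A b.
  move=> Fb; split=> //.
  by have [s [ip [lp [[_ ?] _ _]]]] := IG_reduced Fb; exists ip.
pose P (s : (`|A 0%R j|%N.-1).-bseq 'I_n) := `[< exists2 b,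
  IP_feasible_bounded (R := R) c A b
  & is_IG c A b (\sum_(i <- s) reduced_cost i) >].
(* The right-hand side 0 shows that some list is realised. *)
have F0 : exists x, IP_feasible A 0 x.
  by exists 0; split=> [|i]; rewrite ?mulmx0 ?mxE// raddf0.
have [s0 IG0] := IG_reduced F0.
have Ps0 : P s0 by apply/asboolP; exists 0 => //; exact: bounded.
case: (arg_maxP (fun s : (`|A 0%R j|%N.-1).-bseq 'I_n =>
  \sum_(i <- s) reduced_cost i) Ps0) => s1 /asboolP[b Fb IGb] s1max.
exists (\sum_(i <- s1) reduced_cost i); last exact: sum_reduced_cost_le.
split=> [|b' Fb']; first by exists b.
have [s IGs] := IG_reduced Fb'.1.
exists (\sum_(i <- s) reduced_cost i) => //; apply: s1max.
by apply/asboolP; exists b'.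
Qed.

End Knapsack.

Lemma Gap_knapsack_le (R : realType) (n : nat) (A : 'rV[int]_n)
    (c : 'rV[rat]_n) :
  (0 < n)%N -> (forall i, 0 < A 0 i) ->
  exists2 g : R, is_Gap c A g & g <= (normoo A - 1)%:~R * ratr (norm1 c).
Proof.
case: n A c => // n A c _ A0.
have [j _ jmin] := arg_minP (fun i => c 0 i / (A 0 i)%:~R) (erefl (predT ord0)).
by apply: (Gap_le A0 (j := j)) => i; exact: jmin.
Qed.

(** * A family of instances attaining the bound *)

Section Sharpness.
Variables (n k : nat).
Hypothesis k_gt0 : (0 < k)%N.

(** The dimension [n.+2] keeps [ord0] and [ord_max] distinct, so that a free item of weight [k] is
    present. *)
Definition sharp_row : 'rV[int]_n.+2 :=
  \row_i (if i == ord_max then 1 else k%:Z).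

Definition sharp_cost : 'rV[rat]_n.+2 := delta_mx 0 ord_max.

Lemma sharp_row_gt0 i : 0 < sharp_row 0 i.
Proof. by rewrite mxE; case: ifP; rewrite ?ltz_nat. Qed.

Lemma row_gcd_sharp : row_gcd sharp_row = 1%N.
Proof.
apply/eqP; rewrite -dvdn1 /row_gcd.
by rewrite (bigD1 ord_max)//= mxE eqxx gcd1n.
Qed.

Lemma normoo_sharp : normoo sharp_row = k%:Z.
Proof.
apply/le_anti/andP; split.
  apply/bigmax_leP; split=> // i _; rewrite mxE.
  by case: ifP => _; lia.
apply: le_trans (le_normoo sharp_row ord0).
by rewrite mxE.
Qed.

Lemma norm1_sharp : norm1 sharp_cost = 1.
Proof.
rewrite /norm1 (bigD1 ord_max)//= big1 => [|i /negPf ij].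
  by rewrite mxE !eqxx normr1 addr0.
by rewrite mxE ij normr0.
Qed.

(** A single item of weight [k] already exceeds the capacity [k - 1], so all the weight must come
    from the item of weight and cost 1. *)
Lemma IP_sharp_ge (R : realType) (v : R) :
  IP_values sharp_cost sharp_row (k%:Z - 1) v -> (k%:Z - 1)%:~R <= v.
Proof.
move=> /IP_valuesP[s ks ->].
pose q := count_mem ord_max s; pose p := count (predC1 (@ord_max n.+1)) s.
have -> : \sum_(i <- s) ratr (sharp_cost 0 i) = q%:R :> R.
  rewrite /q -sum1_count natr_sum [RHS]big_mkcond; apply: eq_bigr => i _.
  by rewrite mxE eqxx /=; case: ifP; rewrite ?rmorph1 ?rmorph0.
have kpq : k%:Z - 1 = p%:Z * k%:Z + q%:Z.
  rewrite ks /p /q; elim: (s) => [|i s' IH]; first by rewrite big_nil mul0r.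
  rewrite big_cons IH mxE /=; case: eqP => _ /=; lia.
rewrite -[q%:R]/(q%:Z%:~R) ler_int kpq.
have [->|p0] := posnP p; first by rewrite mul0r add0r.
by have := leq_pmull k p0; lia.
Qed.

Lemma Gap_sharp (R : realType) :
  is_Gap sharp_cost sharp_row
    ((normoo sharp_row - 1)%:~R * ratr (norm1 sharp_cost) : R).
Proof.
(* The general bound provides the maximum [g] and one inequality; for the other, a single [b] whose
   gap reaches the bound suffices. *)
have [//||g gap gle] := @Gap_knapsack_le R n.+2 sharp_row sharp_cost.
  exact: sharp_row_gt0.
suff <- : g = (normoo sharp_row - 1)%:~R * ratr (norm1 sharp_cost) by [].
apply/le_anti; rewrite gle /= norm1_sharp rmorph1 mulr1 normoo_sharp.
(* Item [ord0] costs nothing, so its ratio 0 is minimal and the relaxation has value 0. *)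
have jmin i : sharp_cost 0 ord0 / (sharp_row 0 ord0)%:~R
    <= sharp_cost 0 i / (sharp_row 0 i)%:~R.
  rewrite [X in X / _]mxE /= mul0r divr_ge0 ?ler0z ?(ltW (sharp_row_gt0 i))//.
  by rewrite mxE ler0n.
have F : IP_feasible_bounded (R := R) sharp_cost sharp_row (k%:Z - 1).
  split.
    exists ((k%:Z - 1) *: delta_mx ord_max 0); split=> [|i].
      rewrite -scalemxAr -colE; apply/matrixP => r t.
      by rewrite !ord1 !mxE eqxx mulr1 mulr1n.
    by rewrite !mxE mulr_ge0 ?ler0n//; lia.
  by exists (k%:Z - 1)%:~R => v /IP_sharp_ge.
have [h [ip [lp [[ipv _] lpmin ->]]] hg] := gap.2 _ F.
have b0 : 0 <= k%:Z - 1 by lia.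
have := is_min_unique lpmin (LP_min sharp_row_gt0 jmin b0).
rewrite /best_ratio [X in X / _]mxE /= mul0r rmorph0 mul0r => lp0.
by apply: le_trans hg; rewrite lp0 subr0; exact: IP_sharp_ge.
Qed.

End Sharpness.

Theorem theorem1 (R : realType) (n : nat) (hn : (2 <= n)%N) :
  (forall (A : 'rV[int]_n) (c : 'rV[rat]_n),
     (forall i, 0 < A 0 i) -> row_gcd A = 1%N ->
     exists2 g : R, is_Gap c A g & g <= (normoo A - 1)%:~R * ratr (norm1 c))
  /\
  (forall k : nat, (0 < k)%N ->
     exists (A : 'rV[int]_n) (c : 'rV[rat]_n),
       [/\ forall i, 0 < A 0 i, row_gcd A = 1%N, normoo A = k%:Z
         & is_Gap c A ((normoo A - 1)%:~R * ratr (norm1 c) : R)]).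
Proof.
split=> [A c A0 _|k k0]; first by apply: Gap_knapsack_le => //; exact: ltnW.
case: n hn => [|[|n]] // _; exists (sharp_row n k), (sharp_cost n); split.
- exact: sharp_row_gt0.
- exact: row_gcd_sharp.
- exact: normoo_sharp.
- exact: Gap_sharp.
Qed.
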